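(* Suppose that the pair $(\Gamma A,\ \Gamma B_1-B_2\Theta_1^{-1}\Phi^{\mathsf T})$ is stabilizable (i.e. there is at least one $G\in\mathbb{R}^{\gamma\times p}$ such that $\Gamma A+(\Gamma B_1-B_2\Theta_1^{-1}\Phi^{\mathsf T})G$ is Schur stable). Then BiMPC is stabilizable, in the following sense. Let $G\in\mathbb{R}^{\gamma\times p}$ be any matrix such that $$Z=\Gamma A+(\Gamma B_1-B_2\Theta_1^{-1}\Phi^{\mathsf T})G$$ is Schur stable, let $H\in\mathbb{R}^{p\times p}$ be the unique positive definite matrix solving the discrete-time Lyapunov equation $Z^{\mathsf T}HZ-H=-\mathbb{I}$, and let $\Xi$ be the set defined (using this $G$) in the context. If $\xi_0\in\Xi$ and $$X=\{\xi\in\mathbb{R}^p:\ \xi^{\mathsf T}H\xi\le \xi_0^{\mathsf T}H\xi_0\}\subseteq\Xi,$$ then BiMPC with the choice $$h(\xi_0,\boldsymbol\xi)=\xi_1^{\mathsf T}H\xi_1-\xi_0^{\mathsf T}(H-\mathbb{I})\xi_0$$ (where, at every time step, the current state plays the role of $\xi_0$ in the problem $\mathbf{P}_B(\xi_0)$ and in $h$) stabilizes the control system, is recursively feasible, and ensures that the closed-loop trajectory started at $\xi_0$ satisfies $\xi_n\in\mathcal{X}\times\mathcal{Y}$, $u_n\in\mathcal{U}$ and $w_n\in\mathcal{W}$ for all $n\ge 0$.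
   Context: Notation: for an integer $r\ge 1$, $\langle r\rangle=\{0,\dots,r-1\}$ and $[r]=\{1,\dots,r\}$ ($[0]=\emptyset$); $\mathbb{I}$ is the identity matrix. A square matrix is Schur stable if all its eigenvalues have modulus $<1$. System. Let $A\in\mathbb{R}^{p\times p}$, $B\in\mathbb{R}^{p\times q}$; the dynamics are $\xi_{n+1}=A\xi_n+B\nu_n$ with state $\xi=(x,y)$, $x\in\mathbb{R}^\rho$, $y\in\mathbb{R}^{p-\rho}$, and input $\nu=(u,w)$, $u\in\mathbb{R}^\gamma$, $w\in\mathbb{R}^{q-\gamma}$. Write $B=[B_1\ B_2]$ with $B_1\in\mathbb{R}^{p\times\gamma}$, $B_2\in\mathbb{R}^{p\times(q-\gamma)}$. The sets $\mathcal{X}\subset\mathbb{R}^\rho$, $\mathcal{Y}\subset\mathbb{R}^{p-\rho}$, $\mathcal{U}\subset\mathbb{R}^\gamma$, $\mathcal{W}\subset\mathbb{R}^{q-\gamma}$ are compact, non-singleton polytopes containing the origin. The matrices $U,V\in\mathbb{R}^{p\times p}$ are positive semidefinite, and $W=\begin{bmatrix}W_1&\Phi\\ \Phi^{\mathsf T}&W_2\end{bmatrix}\in\mathbb{R}^{q\times q}$ with $\Phi\in\mathbb{R}^{\gamma\times(q-\gamma)}$ and $W_2\in\mathbb{R}^{(q-\gamma)\times(q-\gamma)}$ positive definite. $N\ge 1$ is a finite horizon; $\boldsymbol\xi=(\xi_1,\dots,\xi_N)$, $\mathbf{u}=(u_0,\dots,u_{N-1})$, $\mathbf{w}=(w_0,\dots,w_{N-1})$,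 and $\xi_n=(x_n,y_n)$, $\nu_n=(u_n,w_n)$. Terminal set. For a given $K_L\in\mathbb{R}^{(q-\gamma)\times p}$, $\mathcal{Y}_\Omega\subseteq\mathbb{R}^{p-\rho}$ is a polyhedron (given by finitely many non-strict linear inequalities) such that (i) $\mathcal{Y}_\Omega\subseteq\mathcal{Y}$ and $K_L\xi\in\mathcal{W}$ whenever $(x,y)\in\mathcal{X}\times\mathcal{Y}_\Omega$; (ii) the $y$-component of $(A+B_2K_L)\xi+B_1u$ lies in $\mathcal{Y}_\Omega$ whenever $(x,y,u)\in\mathcal{X}\times\mathcal{Y}_\Omega\times\mathcal{U}$. LoMPC. Given $\xi_0$ and $\mathbf{u}$, $\mathbf{P}_L(\xi_0,\mathbf{u})$ is the problem of minimizing over $(\boldsymbol\xi,\mathbf{w})$ the cost $\xi_N^{\mathsf T}U\xi_N+\sum_{n=0}^{N-1}(\xi_n^{\mathsf T}V\xi_n+\nu_n^{\mathsf T}W\nu_n)$ subject to $\xi_{n+1}=A\xi_n+B\nu_n$, $y_n\in\mathcal{Y}$, $w_n\in\mathcal{W}$ for $n\in\langle N\rangle$, and $y_N\in\mathcal{Y}_\Omega$. BiMPC. Let $P,Q\in\mathbb{R}^{p\times p}$, $R\in\mathbb{R}^{q\times q}$ be positive semidefinite. $\mathbf{P}_B(\xi_0)$ is the problem of minimizing over $(\boldsymbol\xi,\mathbf{u},\mathbf{w})$ the cost $\xi_N^{\mathsf T}P\xi_N+\sum_{n=0}^{N-1}(\xi_n^{\mathsf T}Q\xi_n+\nu_n^{\mathsf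 T}R\nu_n)$ subject to: $(\boldsymbol\xi,\mathbf{w})$ is a minimizer of $\mathbf{P}_L(\xi_0,\mathbf{u})$; $h(\xi_0,\boldsymbol\xi)\le 0$; $x_n\in\mathcal{X}$, $u_n\in\mathcal{U}$ for $n\in\langle N\rangle$; $x_N\in\mathcal{X}$. Here $h$ is a constraint function to be designed. Closed loop. At each time step the current state is taken as $\xi_0$ in $\mathbf{P}_B$, an optimal solution $(\boldsymbol\xi,\mathbf{u},\mathbf{w})$ is computed, the first inputs $u_0$ and $w_0$ are applied (so the next state is the $\xi_1$ of that solution), and this is repeated. ''Recursively feasible'' means that $\mathbf{P}_B$ is feasible at the initial state and at every state subsequently reached in closed loop. ''Stabilizes the control system'' means that the origin is asymptotically stable for the closed loop (Lyapunov stable, and trajectories converge to the origin) for initial states in $X$. Auxiliary matrices. Set $\Lambda_N=U$ and, for $n\in[N]$ (backward recursion), $$\Theta_n=W_2+B_2^{\mathsf T}\Lambda_nB_2,\quad \Lambda_{n-1}=A^{\mathsf T}\Lambda_nA-A^{\mathsf T}\Lambda_nB_2\Theta_n^{-1}B_2^{\mathsf T}\Lambda_nA+V,\quad \Psi_{n-1}=-\Theta_n^{-1}B_2^{\mathsf T}\Lambda_nA,$$ and $\Gamma=\mathbb{I}-B_2\Theta_1^{-1}B_2^{\mathsf T}\Lambda_1$. The set $\Xi$. For a matrix $G\in\mathbb{R}^{\gamma\times p}$, $\Xi$ is the set of $\xi_0=(x_0,y_0)\in\mathbb{R}^p$ such that, defining $\xi_1=(\Gamma A+(\Gamma B_1-B_2\Theta_1^{-1}\Phi^{\mathsf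 T})G)\xi_0$ and $\xi_{n+1}=(A+B_2\Psi_n)\xi_n$ for $n\in[N-1]$, one has: $G\xi_0\in\mathcal{U}$; $-\Theta_1^{-1}(B_2^{\mathsf T}\Lambda_1(A+B_1G)+\Phi^{\mathsf T}G)\xi_0\in\mathcal{W}$; $\Psi_n\xi_n\in\mathcal{W}$ for $n\in[N-1]$; $x_n\in\mathcal{X}$ and $y_n\in\mathcal{Y}$ for $n\in\langle N\rangle$; $x_N\in\mathcal{X}$ and $y_N\in\mathcal{Y}_\Omega$. *)

(* Defs.v *)
From HB Require Import structures.
From mathcomp Require Import all_boot all_order all_algebra.
From mathcomp Require Import all_classical all_reals all_analysis.
From mathcomp Require Import complex.

Set Implicit Arguments.
Unset Strict Implicit.
Unset Printing Implicit Defensive.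

Import Order.TTheory GRing.Theory Num.Theory.
Import numFieldNormedType.Exports.

Local Open Scope classical_set_scope.
Local Open Scope ring_scope.

Definition qform (R : realType) (n : nat) (M : 'M[R]_n) (v : 'cV[R]_n) : R :=
  (v^T *m M *m v) 0 0.

Definition posdef (R : realType) (n : nat) (M : 'M[R]_n) : Prop :=
  M^T = M /\ forall v : 'cV[R]_n, v != 0 -> 0 < qform M v.

Definition possemidef (R : realType) (n : nat) (M : 'M[R]_n) : Prop :=
  M^T = M /\ forall v : 'cV[R]_n, 0 <= qform M v.

(* Complex eigenvalues: M is mapped into R[i] first. *)
Definition schur_stable (R : realType) (n : nat) (M : 'M[R]_n) : Prop :=
  forall l : R[i], eigenvalue (map_mx (real_complex R) M) l -> `|l| < 1.

Definition stabilizable (R : realType) (n m : nat)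
    (F : 'M[R]_n) (E : 'M[R]_(n, m)) : Prop :=
  exists G : 'M[R]_(m, n), schur_stable (F + E *m G).

Definition lyapunov_solution (R : realType) (n : nat) (Z H : 'M[R]_n) : Prop :=
  posdef H /\ Z^T *m H *m Z - H = - 1%:M.

Definition polyhedron (R : realType) (n : nat) (S : set 'cV[R]_n) : Prop :=
  exists (m : nat) (F : 'M[R]_(m, n)) (g : 'cV[R]_m),
    S = [set s | forall i, (F *m s) i 0 <= g i 0].

Definition constraint_polytope (R : realType) (n : nat)
    (S : set 'cV[R]_n) : Prop :=
  [/\ polyhedron S, compact S, S 0 & ~ exists s, S = [set s]].

(* The dimensions are p = rho + sigma and q = gamma + omega: a state is
   xi = col_mx x y and an input is nu = col_mx u w. *)
Record mpc (R : realType) (rho sigma gamma omega : nat) := Mpc {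
  horizon : nat;
  mA : 'M[R]_(rho + sigma);
  mB : 'M[R]_(rho + sigma, gamma + omega);
  polX : set 'cV[R]_rho;
  polY : set 'cV[R]_sigma;
  polU : set 'cV[R]_gamma;
  polW : set 'cV[R]_omega;
  polYO : set 'cV[R]_sigma;
  mU : 'M[R]_(rho + sigma);
  mV : 'M[R]_(rho + sigma);
  mW1 : 'M[R]_gamma;
  mPhi : 'M[R]_(gamma, omega);
  mW2 : 'M[R]_omega;
  mP : 'M[R]_(rho + sigma);
  mQ : 'M[R]_(rho + sigma);
  mR : 'M[R]_(gamma + omega) }.

Definition mB1 (R : realType) (rho sigma gamma omega : nat)
  (D : mpc R rho sigma gamma omega) : 'M[R]_(rho + sigma, gamma) :=
  lsubmx (mB D).

Definition mB2 (R : realType) (rho sigma gamma omega : nat)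
  (D : mpc R rho sigma gamma omega) : 'M[R]_(rho + sigma, omega) :=
  rsubmx (mB D).

Definition mW (R : realType) (rho sigma gamma omega : nat)
  (D : mpc R rho sigma gamma omega) : 'M[R]_(gamma + omega) :=
  block_mx (mW1 D) (mPhi D) (mPhi D)^T (mW2 D).

Record mpc_assumptions (R : realType) (rho sigma gamma omega : nat)
    (D : mpc R rho sigma gamma omega) : Prop := MpcAssumptions {
  horizon_ge1 : (1 <= horizon D)%N;
  polX_polytope : constraint_polytope (polX D);
  polY_polytope : constraint_polytope (polY D);
  polU_polytope : constraint_polytope (polU D);
  polW_polytope : constraint_polytope (polW D);
  mU_psd : possemidef (mU D);
  mV_psd : possemidef (mV D);
  mW2_pd : posdef (mW2 D);
  mP_psd : possemidef (mP D);
  mQ_psd : possemidef (mQ D);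
  mR_psd : possemidef (mR D) }.

Record terminal_set (R : realType) (rho sigma gamma omega : nat)
    (D : mpc R rho sigma gamma omega) (KL : 'M[R]_(omega, rho + sigma)) : Prop :=
  TerminalSet {
  polYO_polyhedron : polyhedron (polYO D);
  polYO_sub : polYO D `<=` polY D;
  polYO_input : forall x y, polX D x -> polYO D y ->
    polW D (KL *m col_mx x y);
  polYO_invariant : forall x y u, polX D x -> polYO D y -> polU D u ->
    polYO D (dsubmx ((mA D + mB2 D *m KL) *m col_mx x y + mB1 D *m u)) }.

(* In the optimization problems a state sequence also carries the initial state,
   xi 0 = xi0.  Sequences are indexed by nat, and only the entries xi n with
   n <= N and u n, w n with n < N are constrained or enter the costs. *)

Definition horizon_cost (R : realType) (rho sigma gamma omega : nat) (N : nat)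
    (T S : 'M[R]_(rho + sigma)) (E : 'M[R]_(gamma + omega))
    (xi : nat -> 'cV[R]_(rho + sigma))
    (u : nat -> 'cV[R]_gamma) (w : nat -> 'cV[R]_omega) : R :=
  qform T (xi N) +
  \sum_(n < N) (qform S (xi n) + qform E (col_mx (u n) (w n))).

Definition lompc_cost (R : realType) (rho sigma gamma omega : nat)
    (D : mpc R rho sigma gamma omega) xi u w : R :=
  horizon_cost (horizon D) (mU D) (mV D) (mW D) xi u w.

Definition lompc_feasible (R : realType) (rho sigma gamma omega : nat)
    (D : mpc R rho sigma gamma omega) (xi0 : 'cV[R]_(rho + sigma))
    (u : nat -> 'cV[R]_gamma)
    (xi : nat -> 'cV[R]_(rho + sigma)) (w : nat -> 'cV[R]_omega) : Prop :=
  [/\ xi 0%N = xi0,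
      forall n, (n < horizon D)%N ->
        xi n.+1 = mA D *m xi n + mB D *m col_mx (u n) (w n),
      forall n, (n < horizon D)%N -> polY D (dsubmx (xi n)) /\ polW D (w n) &
      polYO D (dsubmx (xi (horizon D)))].

Definition lompc_minimizer (R : realType) (rho sigma gamma omega : nat)
    (D : mpc R rho sigma gamma omega) (xi0 : 'cV[R]_(rho + sigma))
    (u : nat -> 'cV[R]_gamma)
    (xi : nat -> 'cV[R]_(rho + sigma)) (w : nat -> 'cV[R]_omega) : Prop :=
  lompc_feasible D xi0 u xi w /\
  forall xi' w', lompc_feasible D xi0 u xi' w' ->
    lompc_cost D xi u w <= lompc_cost D xi' u w'.

Definition bimpc_cost (R : realType) (rho sigma gamma omega : nat)
    (D : mpc R rho sigma gamma omega) xi u w : R :=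
  horizon_cost (horizon D) (mP D) (mQ D) (mR D) xi u w.

(* h is the design constraint h(xi0, xi) <= 0. *)
Definition bimpc_feasible (R : realType) (rho sigma gamma omega : nat)
    (D : mpc R rho sigma gamma omega)
    (h : 'cV[R]_(rho + sigma) -> (nat -> 'cV[R]_(rho + sigma)) -> R)
    (xi0 : 'cV[R]_(rho + sigma)) (xi : nat -> 'cV[R]_(rho + sigma))
    (u : nat -> 'cV[R]_gamma) (w : nat -> 'cV[R]_omega) : Prop :=
  [/\ lompc_minimizer D xi0 u xi w,
      h xi0 xi <= 0,
      forall n, (n < horizon D)%N -> polX D (usubmx (xi n)) /\ polU D (u n) &
      polX D (usubmx (xi (horizon D)))].

Definition bimpc_optimal (R : realType) (rho sigma gamma omega : nat)
    (D : mpc R rho sigma gamma omega)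
    (h : 'cV[R]_(rho + sigma) -> (nat -> 'cV[R]_(rho + sigma)) -> R)
    (xi0 : 'cV[R]_(rho + sigma)) (xi : nat -> 'cV[R]_(rho + sigma))
    (u : nat -> 'cV[R]_gamma) (w : nat -> 'cV[R]_omega) : Prop :=
  bimpc_feasible D h xi0 xi u w /\
  forall xi' u' w', bimpc_feasible D h xi0 xi' u' w' ->
    bimpc_cost D xi u w <= bimpc_cost D xi' u' w'.

(* One receding-horizon step, from z to z' with applied inputs u0, w0; any
   optimal solution may be the one that is computed. *)
Definition closed_loop_step (R : realType) (rho sigma gamma omega : nat)
    (D : mpc R rho sigma gamma omega)
    (h : 'cV[R]_(rho + sigma) -> (nat -> 'cV[R]_(rho + sigma)) -> R)
    (z : 'cV[R]_(rho + sigma)) (u0 : 'cV[R]_gamma) (w0 : 'cV[R]_omega)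
    (z' : 'cV[R]_(rho + sigma)) : Prop :=
  exists xi u w, [/\ bimpc_optimal D h z xi u w,
    u0 = u 0%N, w0 = w 0%N & z' = xi 1%N].

Definition closed_loop (R : realType) (rho sigma gamma omega : nat)
    (D : mpc R rho sigma gamma omega)
    (h : 'cV[R]_(rho + sigma) -> (nat -> 'cV[R]_(rho + sigma)) -> R)
    (z : nat -> 'cV[R]_(rho + sigma))
    (u : nat -> 'cV[R]_gamma) (w : nat -> 'cV[R]_omega) : Prop :=
  forall t, closed_loop_step D h (z t) (u t) (w t) (z t.+1).

Inductive reachable (R : realType) (rho sigma gamma omega : nat)
    (D : mpc R rho sigma gamma omega)
    (h : 'cV[R]_(rho + sigma) -> (nat -> 'cV[R]_(rho + sigma)) -> R)
    (z0 : 'cV[R]_(rho + sigma)) : 'cV[R]_(rho + sigma) -> Prop :=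
| reachable_init : reachable D h z0 z0
| reachable_step z u0 w0 z' :
    reachable D h z0 z -> closed_loop_step D h z u0 w0 z' ->
    reachable D h z0 z'.

(* The closed loop is followed for finitely many steps only: feasibility of a
   state does not presuppose that the run can be continued from it. *)
Definition recursively_feasible (R : realType) (rho sigma gamma omega : nat)
    (D : mpc R rho sigma gamma omega)
    (h : 'cV[R]_(rho + sigma) -> (nat -> 'cV[R]_(rho + sigma)) -> R)
    (z0 : 'cV[R]_(rho + sigma)) : Prop :=
  forall z, reachable D h z0 z -> exists xi u w, bimpc_feasible D h z xi u w.

Definition asymptotically_stable (R : realType) (n : nat)
    (traj : set (nat -> 'cV[R]_n)) (S : set 'cV[R]_n) : Prop :=
  (forall e : R, 0 < e -> exists2 d : R, 0 < d &
     forall z, traj z -> S (z 0%N) -> `|z 0%N| < d -> forall t, `|z t| < e) /\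
  (forall z, traj z -> S (z 0%N) -> z @ \oo --> (0 : 'cV[R]_n)).

Definition stabilizes (R : realType) (rho sigma gamma omega : nat)
    (D : mpc R rho sigma gamma omega)
    (h : 'cV[R]_(rho + sigma) -> (nat -> 'cV[R]_(rho + sigma)) -> R)
    (S : set 'cV[R]_(rho + sigma)) : Prop :=
  asymptotically_stable [set z | exists u w, closed_loop D h z u w] S.

Definition Theta_of (R : realType) (rho sigma gamma omega : nat)
    (D : mpc R rho sigma gamma omega) (L : 'M[R]_(rho + sigma)) : 'M[R]_omega :=
  mW2 D + (mB2 D)^T *m L *m mB2 D.

Definition riccati (R : realType) (rho sigma gamma omega : nat)
    (D : mpc R rho sigma gamma omega) (L : 'M[R]_(rho + sigma)) :
    'M[R]_(rho + sigma) :=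
  (mA D)^T *m L *m mA D
  - (mA D)^T *m L *m mB2 D *m invmx (Theta_of D L) *m (mB2 D)^T *m L *m mA D
  + mV D.

(* Backward recursion from Lambda_N = U; meant for n <= N. *)
Definition Lambda (R : realType) (rho sigma gamma omega : nat)
    (D : mpc R rho sigma gamma omega) (n : nat) : 'M[R]_(rho + sigma) :=
  iter (horizon D - n) (riccati D) (mU D).

Definition Theta (R : realType) (rho sigma gamma omega : nat)
    (D : mpc R rho sigma gamma omega) (n : nat) : 'M[R]_omega :=
  Theta_of D (Lambda D n).

(* Psi_{n-1} is given by Theta_n and Lambda_n. *)
Definition Psi (R : realType) (rho sigma gamma omega : nat)
    (D : mpc R rho sigma gamma omega) (n : nat) : 'M[R]_(omega, rho + sigma) :=
  - (invmx (Theta D n.+1) *m (mB2 D)^T *m Lambda D n.+1 *m mA D).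

Definition Gamma (R : realType) (rho sigma gamma omega : nat)
    (D : mpc R rho sigma gamma omega) : 'M[R]_(rho + sigma) :=
  1%:M - mB2 D *m invmx (Theta D 1) *m (mB2 D)^T *m Lambda D 1.

Definition stab_A (R : realType) (rho sigma gamma omega : nat)
    (D : mpc R rho sigma gamma omega) : 'M[R]_(rho + sigma) :=
  Gamma D *m mA D.

Definition stab_B (R : realType) (rho sigma gamma omega : nat)
    (D : mpc R rho sigma gamma omega) : 'M[R]_(rho + sigma, gamma) :=
  Gamma D *m mB1 D - mB2 D *m invmx (Theta D 1) *m (mPhi D)^T.

Definition mZ (R : realType) (rho sigma gamma omega : nat)
    (D : mpc R rho sigma gamma omega) (G : 'M[R]_(gamma, rho + sigma)) :
    'M[R]_(rho + sigma) :=
  stab_A D + stab_B D *m G.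

Fixpoint Xi_state (R : realType) (rho sigma gamma omega : nat)
    (D : mpc R rho sigma gamma omega) (G : 'M[R]_(gamma, rho + sigma))
    (xi0 : 'cV[R]_(rho + sigma)) (n : nat) {struct n} : 'cV[R]_(rho + sigma) :=
  match n with
  | 0 => xi0
  | n'.+1 =>
      match n' with
      | 0 => mZ D G *m xi0
      | _.+1 => (mA D + mB2 D *m Psi D n') *m Xi_state D G xi0 n'
      end
  end.

Definition Xi (R : realType) (rho sigma gamma omega : nat)
    (D : mpc R rho sigma gamma omega) (G : 'M[R]_(gamma, rho + sigma)) :
    set 'cV[R]_(rho + sigma) :=
  [set xi0 | let xi := Xi_state D G xi0 in let N := horizon D in
    [/\ polU D (G *m xi0),
        polW D (- (invmx (Theta D 1) *m
          ((mB2 D)^T *m Lambda D 1 *m (mA D + mB1 D *m G) + (mPhi D)^T *m G)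
          *m xi0)),
        forall n, (1 <= n <= N.-1)%N -> polW D (Psi D n *m xi n),
        forall n, (n < N)%N ->
          polX D (usubmx (xi n)) /\ polY D (dsubmx (xi n)) &
        polX D (usubmx (xi N)) /\ polYO D (dsubmx (xi N))]].

Definition ellipsoid (R : realType) (n : nat) (H : 'M[R]_n) (xi0 : 'cV[R]_n) :
    set 'cV[R]_n :=
  [set xi | qform H xi <= qform H xi0].

Definition lyapunov_constraint (R : realType) (n : nat) (H : 'M[R]_n)
    (xi0 : 'cV[R]_n) (xi : nat -> 'cV[R]_n) : R :=
  qform H (xi 1%N) - qform (H - 1%:M) xi0.

(* Main.v *)
Require Import Defs.
From HB Require Import structures.
From mathcomp Require Import all_boot all_order all_algebra.
From mathcomp Require Import all_classical all_reals all_analysis.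
From mathcomp Require Import complex.
From mathcomp Require Import ring lra.

Set Implicit Arguments.
Unset Strict Implicit.
Unset Printing Implicit Defensive.

Import Order.TTheory GRing.Theory Num.Theory.
Import numFieldNormedType.Exports.

Local Open Scope classical_set_scope.
Local Open Scope ring_scope.

(** Write q(v) = v^T H v.

    The Lyapunov equation.  A Schur stable Z has geometrically decaying orbits
    Z^k v: by Cayley-Hamilton the product of the Z - l, over the eigenvalues l,
    kills v, and each factor can be undone by a scalar recurrence
    a_(k+1) <= |l| a_k + c r^k with |l| < r < 1 ([annihilated_decay]).  If
    H = Z^T H Z, then a^T H b = (Z^k a)^T H (Z^k b) -> 0, so the linear map
    H |-> H - Z^T H Z on a finite-dimensional space is injective, hence onto.
    The preimage of the identity is the unique solution; it is symmetric by
    uniqueness, and letting k grow in q(Z^k v) <= q(v) - |v|_2^2 gives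
    q(v) >= |v|_2^2 ([stein_qform_ge]).

    The lower level.  Completing the square in one Riccati step turns the
    lower-level cost of a trajectory whose upper inputs vanish after time 0
    into a term independent of w plus nonnegative squares weighted by Theta
    ([stage_valueE], [lompc_cost_eq]).  All squares vanish for the trajectory
    that defines Xi, driven by the upper inputs (G xi0, 0, ..., 0): this is an
    unconstrained optimal reply, and as membership of xi0 in Xi says that it
    obeys the constraints of both levels, it is a lower-level minimizer.  Its
    state at time 1 is Z xi0, so the design constraint holds with equality.  Thus every point of Xi
    is feasible for the upper level ([Xi_bimpc_feasible]).

    The closed loop.  Whatever optimal solution is applied, the design
    constraint reads q(z') <= q(z) - |z|_2^2.  So sublevel sets of q are
    invariant, which inside Xi gives recursive feasibility; and since q is
    comparable to the squared norm, q decays geometrically along every closed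
    loop, which gives asymptotic stability.  The state and input constraints
    hold because they are imposed at time 0 of each problem solved. *)

(** * Bilinear and quadratic forms *)

Definition bform (R : realType) (m n : nat) (M : 'M[R]_(m, n))
    (a : 'cV[R]_m) (b : 'cV[R]_n) : R :=
  (a^T *m M *m b) 0 0.

Section Bform.
Variable R : realType.
Implicit Types m n : nat.

Lemma qformE n (M : 'M[R]_n) v : qform M v = bform M v v.
Proof. by []. Qed.

Lemma bformDl m n (M : 'M[R]_(m, n)) a a' b :
  bform M (a + a') b = bform M a b + bform M a' b.
Proof. by rewrite /bform linearD /= !mulmxDl mxE. Qed.

Lemma bformDr m n (M : 'M[R]_(m, n)) a b b' :
  bform M a (b + b') = bform M a b + bform M a b'.
Proof. by rewrite /bform mulmxDr mxE. Qed.

Lemma bformNl m n (M : 'M[R]_(m, n)) a b : bform M (- a) b = - bform M a b.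
Proof. by rewrite /bform linearN /= !mulNmx mxE. Qed.

Lemma bformNr m n (M : 'M[R]_(m, n)) a b : bform M a (- b) = - bform M a b.
Proof. by rewrite /bform mulmxN mxE. Qed.

Lemma bformDm m n (M M' : 'M[R]_(m, n)) a b :
  bform (M + M') a b = bform M a b + bform M' a b.
Proof. by rewrite /bform mulmxDr mulmxDl mxE. Qed.

Lemma bformNm m n (M : 'M[R]_(m, n)) a b : bform (- M) a b = - bform M a b.
Proof. by rewrite /bform mulmxN mulNmx mxE. Qed.

Lemma bform_mulml m m' n (M : 'M[R]_(m, n)) (A : 'M[R]_(m, m')) a b :
  bform M (A *m a) b = bform (A^T *m M) a b.
Proof. by rewrite /bform trmx_mul !mulmxA. Qed.

Lemma bform_mulmr m n n' (M : 'M[R]_(m, n)) (A : 'M[R]_(n, n')) a b :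
  bform M a (A *m b) = bform (M *m A) a b.
Proof. by rewrite /bform !mulmxA. Qed.

Lemma bformC m n (M : 'M[R]_(m, n)) a b : bform M a b = bform M^T b a.
Proof.
by rewrite /bform -[in LHS](trmxK (_ *m _)) mxE !trmx_mul trmxK mulmxA.
Qed.

Lemma bform_delta m n (M : 'M[R]_(m, n)) i j :
  bform M (delta_mx i 0) (delta_mx j 0) = M i j.
Proof. by rewrite /bform trmx_delta -rowE -colE !mxE. Qed.

Lemma qformD n (M : 'M[R]_n) a b : M^T = M ->
  qform M (a + b) = qform M a + 2 * bform M a b + qform M b.
Proof.
by move=> sM; rewrite !qformE !bformDl !bformDr [bform M b a]bformC sM; ring.
Qed.

Lemma qformN n (M : 'M[R]_n) a : qform M (- a) = qform M a.
Proof. by rewrite !qformE bformNl bformNr opprK. Qed.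

Lemma qform0 n (M : 'M[R]_n) : qform M 0 = 0.
Proof. by rewrite /qform mulmx0 mxE. Qed.

Lemma qform_mulm m n (M : 'M[R]_n) (A : 'M[R]_(n, m)) a :
  qform M (A *m a) = qform (A^T *m M *m A) a.
Proof. by rewrite !qformE bform_mulml bform_mulmr. Qed.

Lemma qform_block m n (P : 'M[R]_m) (S : 'M[R]_(m, n)) (Q : 'M[R]_n) a b :
  qform (block_mx P S S^T Q) (col_mx a b) =
  qform P a + 2 * bform S a b + qform Q b.
Proof.
rewrite /qform tr_col_mx -mulmxA mul_block_col mul_row_col !mulmxDr !mulmxA.
have addE (X Y : 'M[R]_1) : (X + Y) 0 0 = X 0 0 + Y 0 0 by rewrite mxE.
rewrite !addE -/(qform P a) -/(qform Q b) -/(bform S a b).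
by rewrite -/(bform S^T b a) -bformC; ring.
Qed.

(** The bound 1 <= c lets c serve as a divisor giving a contraction factor
    1 - 1/c in [0, 1). *)
Lemma bform_bounded m n (M : 'M[R]_(m, n)) :
  exists2 c : R, 1 <= c & forall a b, `|bform M a b| <= c * (`|a| * `|b|).
Proof.
have coord k (v : 'cV[R]_k) i : `|v i 0| <= `|v|.
  rewrite [`|v|]mx_normrE; apply: le_trans (le_bigmax _ _ (i, 0)) => /=.
  by [].
exists (1 + \sum_j \sum_i `|M i j|) => [|a b].
  by rewrite lerDl; apply: sumr_ge0 => j _; apply: sumr_ge0.
have nab : 0 <= `|a| * `|b| by apply: mulr_ge0.
rewrite mulrDl mul1r; apply: ler_wpDl => //.
rewrite /bform mxE mulr_suml; apply: le_trans (ler_norm_sum _ _ _) _.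
apply: ler_sum => j _; rewrite mxE normrM.
apply: le_trans (ler_wpM2r _ (ler_norm_sum _ _ _)) _ => //.
rewrite !mulr_suml; apply: ler_sum => i _; rewrite !mxE normrM -mulrA.
rewrite mulrCA ler_wpM2l //; apply: ler_pM => //; exact: coord.
Qed.

(** The norm on column vectors is the sup norm, while the Lyapunov equation
    speaks of the Euclidean one. *)
Lemma sqr_norm_le_qform n (v : 'cV[R]_n) : `|v| ^+ 2 <= qform 1%:M v.
Proof.
have -> : qform 1%:M v = \sum_i (v i 0) ^+ 2.
  by rewrite /qform mulmx1 mxE; apply: eq_bigr => i _; rewrite mxE -expr2.
have [v0|/mx_norm_neq0[[i j] /= vi]] := eqVneq (mx_norm v) 0.
  rewrite [`|v|]v0 expr0n /=; apply: sumr_ge0 => i _; exact: sqr_ge0.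
rewrite [`|v|]vi ord1 real_normK ?num_real // (bigD1 i) //= lerDl.
by apply: sumr_ge0 => k _; apply: sqr_ge0.
Qed.

Lemma qform1_ge0 n (v : 'cV[R]_n) : 0 <= qform 1%:M v.
Proof. by apply: le_trans (sqr_norm_le_qform _); apply: sqr_ge0. Qed.

End Bform.

(** * Orbits of Schur stable matrices *)

Lemma geometric_le0 (R : realType) (x c r : R) :
  0 <= r -> r < 1 -> (forall k, x <= c * r ^+ k) -> x <= 0.
Proof.
move=> r0 r1 xle.
have cg : geometric c r @ \oo --> 0.
  by apply: cvg_geometric; rewrite ger0_norm.
rewrite -(cvg_lim _ cg) //; apply: limr_ge; first by apply/cvg_ex; exists 0.
by apply: nearW => k; exact: xle.
Qed.

(** One rate r for all eigenvalues keeps the exponential rate fixed when the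
    factors Z - l are removed one at a time; only the constant changes. *)
Lemma exists_radius (R : realFieldType) (s : seq R) :
  (forall x, x \in s -> x < 1) ->
  exists2 r, 0 < r < 1 & forall x, x \in s -> x < r.
Proof.
elim: s => [|l s IHs] ls.
  by exists 2^-1 => //; rewrite invr_gt0 ltr0n invf_lt1 ?ltr1n ?ltr0n.
have [x xs|r /andP[r0 r1] rs] := IHs; first by apply: ls; rewrite inE xs orbT.
have l1 : l < 1 by apply: ls; rewrite inE eqxx.
exists (Num.max r ((1 + l) / 2)).
  rewrite lt_max r0 gt_max r1 /=; lra.
move=> x; rewrite inE lt_max => /predU1P[->|/rs -> //].
by apply/orP; right; lra.
Qed.

(** With d the constant of the conclusion, c <= (r - l) d, so a bound
    d r^k at step k gives l d r^k + c r^k <= d r^(k+1). *)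
Lemma geometric_recurrence (R : realFieldType) (a : nat -> R) (l r c : R) :
  0 <= l -> l < r -> 0 <= c -> 0 <= a 0%N ->
  (forall k, a k.+1 <= l * a k + c * r ^+ k) ->
  forall k, a k <= (a 0%N + c / (r - l)) * r ^+ k.
Proof.
move=> l0 lr c0 a0 arec; have rl : 0 < r - l by rewrite subr_gt0.
set d := a 0%N + _.
have cd : c <= (r - l) * d.
  rewrite mulrDr mulrCA divff ?gt_eqF // mulr1 lerDr.
  by apply: mulr_ge0 => //; exact: ltW.
elim=> [|k IHk]; first by rewrite expr0 mulr1 lerDl divr_ge0 // ltW.
apply: le_trans (arec k) _; apply: le_trans (lerD (ler_wpM2l l0 IHk) (lexx _)) _.
have rk : 0 <= r ^+ k by apply/exprn_ge0/ltW/(le_lt_trans l0).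
have := ler_wpM2r rk cd; rewrite exprS; lra.
Qed.

Section SchurDecay.
Variable R : realType.
Local Notation C := R[i].

(** The l^1 norm of a complex vector, valued in R rather than in R[i]. *)
Definition cnorm1 n (v : 'cV[C]_n) : R := \sum_i Normc.normc (v i 0).

Lemma cnorm1_ge0 n (v : 'cV[C]_n) : 0 <= cnorm1 v.
Proof. by apply: sumr_ge0 => i _; case: (v i 0) => a b; exact: sqrtr_ge0. Qed.

Lemma cnorm1D n (v w : 'cV[C]_n) : cnorm1 (v + w) <= cnorm1 v + cnorm1 w.
Proof.
rewrite /cnorm1 -big_split /=; apply: ler_sum => i _; rewrite mxE.
exact: le_normcD.
Qed.

Lemma cnorm1Z n (l : C) (v : 'cV[C]_n) : cnorm1 (l *: v) = Normc.normc l * cnorm1 v.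
Proof. by rewrite /cnorm1 mulr_sumr; apply: eq_bigr => i _; rewrite mxE Normc.normcM. Qed.

(** For w = Z v - l v, annihilated by the remaining factors and hence
    decaying, Z^(k+1) v = l Z^k v + Z^k w is a recurrence of the kind treated
    above.  The fold removes the factors in the order of this induction. *)
Lemma annihilated_decay n (Z : 'M[C]_n) (r : R) (s : seq C) :
  0 < r -> (forall l, l \in s -> Normc.normc l < r) -> forall v : 'cV[C]_n,
  foldl (fun w l => Z *m w - l *: w) v s = 0 ->
  exists2 c : R, 0 <= c &
    forall k, cnorm1 (iter k (mulmx Z) v) <= c * r ^+ k.
Proof.
move=> r0; elim: s => [_ v /= ->|l s IHs sr v /= /IHs[m ms|c c0 cP]].
- exists 0 => // k; rewrite mul0r; have -> : iter k (mulmx Z) (0 : 'cV[C]_n) = 0.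
    by elim: k => //= k ->; rewrite mulmx0.
  by rewrite /cnorm1 big1 // => i _; rewrite mxE Normc.normc0.
- by apply: sr; rewrite inE ms orbT.
have iterB k : iter k (mulmx Z) (Z *m v - l *: v) =
    iter k.+1 (mulmx Z) v - l *: iter k (mulmx Z) v.
  by elim: k => //= k ->; rewrite mulmxBr -scalemxAr.
have lr : Normc.normc l < r by apply: sr; rewrite inE eqxx.
have l0 : 0 <= Normc.normc l by case: (l) => a b; exact: sqrtr_ge0.
exists (cnorm1 v + c / (r - Normc.normc l)).
  by rewrite addr_ge0 ?cnorm1_ge0 // divr_ge0 // subr_ge0 ltW.
apply: geometric_recurrence => //; first exact: cnorm1_ge0.
move=> k; rewrite -cnorm1Z.
rewrite -[X in cnorm1 X <= _](subrK (l *: iter k (mulmx Z) v)) -iterB addrC.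
by apply: le_trans (cnorm1D _ _) _; rewrite lerD2l.
Qed.

Lemma horner_mx_prod_foldl n (Z : 'M[C]_n.+1) (s : seq C) (v : 'cV[C]_n.+1) :
  horner_mx Z (\prod_(l <- s) ('X - l%:P)) *m v =
  foldl (fun w l => Z *m w - l *: w) v s.
Proof.
elim: s v => [|l s IHs] v /=; first by rewrite big_nil rmorph1 mul1mx.
rewrite big_cons mulrC rmorphM /= rmorphB /= horner_mx_X horner_mx_C -IHs.
by rewrite -mulmxA mulmxBl mul_scalar_mx.
Qed.

Lemma schur_stable_decay n (Z : 'M[R]_n) (v : 'cV[R]_n) : schur_stable Z ->
  exists c r : R, [/\ 0 <= c, 0 < r, r < 1 &
    forall k, `|iter k (mulmx Z) v| <= c * r ^+ k].
Proof.
case: n => [|n] in Z v * => Zst.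
  exists 0, 2^-1; split=> //.
  - by rewrite invf_lt1 ?ltr1n ?ltr0n.
  - by move=> k; rewrite [iter _ _ _]flatmx0 normr0 mul0r.
pose ZC := map_mx (real_complex R) Z; pose vC := map_mx (real_complex R) v.
have [s def_s] := closed_field_poly_normal (char_poly ZC).
rewrite (monicP (char_poly_monic _)) scale1r in def_s.
have s1 l : l \in s -> Normc.normc l < 1.
  move=> ls; have : `|l| < 1.
    by apply: Zst; rewrite eigenvalue_root_char def_s root_prod_XsubC.
  by rewrite normc_def => /=; rewrite -(ltcR _ 1); case: (l).
have [|r /andP[r0 r1] rP] := @exists_radius R (map (@Normc.normc R) s).
  by move=> _ /mapP[l /s1 l1 ->].
have [l ls||c c0 cP] := @annihilated_decay _ ZC r s r0 _ vC _.
- by apply: rP; apply: map_f.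
- by rewrite -horner_mx_prod_foldl -def_s Cayley_Hamilton mul0mx.
exists c, r; split=> // k; apply: le_trans (cP k).
have -> : iter k (mulmx ZC) vC = map_mx (real_complex R) (iter k (mulmx Z) v).
  by elim: k => //= k ->; rewrite map_mxM.
set w := iter k _ _; rewrite [`|w|]mx_normrE.
apply: bigmax_le; first exact: cnorm1_ge0.
move=> [i j] _ /=; rewrite ord1 /cnorm1 (bigD1 i) //= mxE /=.
rewrite expr0n addr0 sqrtr_sqr lerDl; apply: sumr_ge0 => m _.
by rewrite mxE; exact: sqrtr_ge0.
Qed.

End SchurDecay.

(** * The discrete Lyapunov equation *)

Section Lyapunov.
Variables (R : realType) (n : nat) (Z : 'M[R]_n).
Hypothesis Zst : schur_stable Z.

(** The Stein operator: the Lyapunov equation is stein H = I. *)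
Definition stein (H : 'M[R]_n) : 'M[R]_n := H - Z^T *m H *m Z.

Fact stein_is_linear : linear stein.
Proof.
move=> a H K; rewrite /stein mulmxDr mulmxDl -scalemxAr -scalemxAl scalerBr.
by rewrite addrACA opprD.
Qed.

HB.instance Definition _ :=
  GRing.isLinear.Build R 'M[R]_n 'M[R]_n *:%R stein stein_is_linear.

Lemma bform_steinE H a b :
  bform H a b = bform (stein H) a b + bform H (Z *m a) (Z *m b).
Proof. by rewrite bform_mulml bform_mulmr -bformDm /stein subrK. Qed.

Lemma bform_orbit_decay H a b : exists c r : R, [/\ 0 <= r, r < 1 &
  forall k, `|bform H (iter k (mulmx Z) a) (iter k (mulmx Z) b)| <= c * r ^+ k].
Proof.
have [ca [ra [ca0 ra0 ra1 aP]]] := schur_stable_decay a Zst.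
have [cb [rb [cb0 rb0 rb1 bP]]] := schur_stable_decay b Zst.
have [c c1 cP] := bform_bounded H.
exists (c * (ca * cb)), (ra * rb); split; first by rewrite mulr_ge0 ?ltW.
  by rewrite mulr_ilt1 ?ltW.
move=> k; apply: le_trans (cP _ _) _; rewrite -mulrA.
apply: ler_wpM2l; first exact: le_trans c1.
rewrite exprMn mulrACA; exact: ler_pM.
Qed.

(** A matrix with H = Z^T H Z has the same bilinear form along two orbits,
    which tend to 0. *)
Lemma stein_inj H : stein H = 0 -> H = 0.
Proof.
move=> H0; apply/matrixP => i j; rewrite mxE -bform_delta.
set a := delta_mx i 0; set b := delta_mx j 0.
have orbit k : bform H a b =
    bform H (iter k (mulmx Z) a) (iter k (mulmx Z) b).
  elim: k => //= k ->; rewrite bform_steinE H0 {1}/bform mulmx0 mul0mx mxE.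
  by rewrite add0r.
have [c [r [r0 r1 P]]] := bform_orbit_decay H a b.
apply/eqP; rewrite -normr_le0.
by apply: (geometric_le0 (c := c) r0 r1) => k; rewrite (orbit k).
Qed.

Lemma stein_surj K : exists H, stein H = K.
Proof.
have free : row_free (lin_mx stein).
  apply: inj_row_free => v; rewrite -[v]vec_mxK mul_vec_lin.
  by move/(canRL mxvecK); rewrite linear0 => /stein_inj ->; rewrite linear0.
exists (vec_mx (mxvec K *m invmx (lin_mx stein))); apply: (can_inj mxvecK).
by rewrite -mul_vec_lin vec_mxK mulmxKV // -row_free_unit.
Qed.

(** Along an orbit the form of H drops by the squared Euclidean norm at each
    step and tends to 0, so the drop of the first step alone is at most its
    initial value.  The bound makes H positive definite and later controls the
    state by the Lyapunov function. *)
Lemma stein_qform_ge H v : stein H = 1%:M -> qform 1%:M v <= qform H v.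
Proof.
move=> H1.
have drop x : qform H (Z *m x) = qform H x - qform 1%:M x.
  by rewrite [qform H x]bform_steinE H1 -!qformE; ring.
(* The index k.+1 leaves room for the drop of the first step. *)
have decr k : qform H (iter k.+1 (mulmx Z) v) <= qform H v - qform 1%:M v.
  elim: k => [|k IHk]; first by rewrite -drop.
  rewrite iterS drop; apply: le_trans IHk; rewrite gerDl oppr_le0.
  exact: qform1_ge0.
have [c [r [r0 r1 P]]] := bform_orbit_decay H v v.
rewrite -subr_le0; apply: (geometric_le0 (c := c * r) r0 r1) => k.
rewrite -mulrA -exprS; apply: le_trans (P k.+1); rewrite -normrN.
apply: le_trans (ler_norm _); rewrite -qformE lerNr opprB; exact: decr.
Qed.

Lemma lyapunov_equation_solvable :
  exists H, unique (lyapunov_solution Z) H /\ stein H = 1%:M.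
Proof.
have eqE H : Z^T *m H *m Z - H = - 1%:M <-> stein H = 1%:M.
  rewrite /stein; split=> [h|<-]; last by rewrite opprB.
  by rewrite -[LHS]opprB h opprK.
have [H H1] := stein_surj 1%:M.
have stein_inj2 K : stein K = 1%:M -> H = K.
  by move=> K1; apply/eqP; rewrite -subr_eq0; apply/eqP/stein_inj;
     rewrite linearB /= H1 K1 subrr.
have sH : H^T = H.
  apply/esym/stein_inj2; rewrite -[RHS]trmx1 -H1 /stein linearB /=.
  by rewrite !trmx_mul trmxK mulmxA.
exists H; split=> //; split; last by move=> K [_ /eqE /stein_inj2].
split; last exact/eqE.
split=> // v v0; apply: lt_le_trans (stein_qform_ge v H1).
apply: lt_le_trans (sqr_norm_le_qform _).
by rewrite exprn_gt0 // normr_gt0.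
Qed.

End Lyapunov.

(** * The Riccati step and lower-level optimality *)

Lemma complete_square (R : realType) n (T : 'M[R]_n) (w s g : 'cV[R]_n) :
  T^T = T -> T *m s = - g ->
  qform T w + 2 * bform 1%:M w g = qform T (w - s) - qform T s.
Proof.
move=> sT Ts; rewrite qformD // qformN bformNr.
have -> : bform T w s = - bform 1%:M w g.
  by rewrite -bformNr -Ts bform_mulmr mul1mx.
ring.
Qed.

Lemma posdef_unitmx (R : realType) n (T : 'M[R]_n) : posdef T -> T \in unitmx.
Proof.
move=> [_ pT]; rewrite -row_free_unit; apply: inj_row_free => v vT0.
apply/eqP; apply/negPn/negP => v0.
have := pT v^T; rewrite /qform trmxK vT0 mul0mx mxE ltxx.
by move=> h; suff: false by []; apply: h; rewrite trmx_eq0.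
Qed.

Section Riccati.
Variables (R : realType) (rho sigma gamma omega : nat).
Variable D : mpc R rho sigma gamma omega.
Hypothesis hD : mpc_assumptions D.
Implicit Types (L : 'M[R]_(rho + sigma)) (xi : 'cV[R]_(rho + sigma)).
Implicit Types (u : 'cV[R]_gamma) (w : 'cV[R]_omega).

Lemma mB_col u w : mB D *m col_mx u w = mB1 D *m u + mB2 D *m w.
Proof. by rewrite -{1}[mB D]hsubmxK mul_row_col. Qed.

Lemma Theta_of_posdef L : possemidef L -> posdef (Theta_of D L).
Proof.
have [sW pW] := mW2_pd hD; move=> [sL pL]; split.
  by rewrite /Theta_of linearD /= sW !trmx_mul trmxK sL mulmxA.
move=> w w0; rewrite qformE bformDm -!qformE -qform_mulm.
by apply: ltr_pwDl; [exact: pW | exact: pL].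
Qed.

(** The cost of one step from xi followed by a cost-to-go with matrix L. *)
Definition stage_value L xi u w : R :=
  qform (mV D) xi + qform (mW D) (col_mx u w) +
  qform L (mA D *m xi + mB D *m col_mx u w).

(** The unconstrained minimizer of [stage_value] over the lower input w. *)
Definition best_reply L xi u : 'cV[R]_omega :=
  - (invmx (Theta_of D L) *m
     ((mB2 D)^T *m L *m (mA D *m xi + mB1 D *m u) + (mPhi D)^T *m u)).

Lemma stage_valueE L xi u w : possemidef L ->
  stage_value L xi u w =
  qform (mV D) xi + qform (mW1 D) u + qform L (mA D *m xi + mB1 D *m u)
  - qform (Theta_of D L) (best_reply L xi u)
  + qform (Theta_of D L) (w - best_reply L xi u).
Proof.
move=> psdL; have [sL _] := psdL; have pT := Theta_of_posdef psdL.
set x := mA D *m xi + mB1 D *m u; set s := best_reply L xi u.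
pose g := (mB2 D)^T *m L *m x + (mPhi D)^T *m u.
have Ts : Theta_of D L *m s = - g.
  by rewrite mulmxN mulmxA mulmxV ?mul1mx ?posdef_unitmx.
have sq := complete_square w pT.1 Ts.
rewrite /stage_value mB_col addrA -/x qform_block (qformD x _ sL).
have -> : bform (mPhi D) u w = bform 1%:M w ((mPhi D)^T *m u).
  by rewrite bform_mulmr mul1mx bformC.
have -> : bform L x (mB2 D *m w) = bform 1%:M w ((mB2 D)^T *m L *m x).
  by rewrite bform_mulmr bformC trmx_mul sL bform_mulmr mul1mx.
rewrite [qform (Theta_of D L) w]qformE bformDm -!qformE -qform_mulm in sq.
rewrite /g bformDr in sq.
by lra.
Qed.

(** The Riccati map is the minimal stage value when the upper input is 0. *)
Lemma riccati_qform L xi : possemidef L ->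
  qform (riccati D L) xi =
  qform (mV D) xi + qform L (mA D *m xi)
  - qform (Theta_of D L) (best_reply L xi 0).
Proof.
move=> psdL; have [sL _] := psdL; have pT := Theta_of_posdef psdL.
rewrite /best_reply !mulmx0 !addr0 qformN !mulmxA !qform_mulm !qformE.
rewrite /riccati !bformDm bformNm addrC addrA; congr (_ - bform _ _ _).
rewrite !trmx_mul trmxK sL trmx_inv pT.1 !mulmxA.
by rewrite mulmxKV ?posdef_unitmx.
Qed.

Lemma stage_value0E L xi w : possemidef L ->
  stage_value L xi 0 w =
  qform (riccati D L) xi + qform (Theta_of D L) (w - best_reply L xi 0).
Proof.
move=> psdL; rewrite stage_valueE // riccati_qform // mulmx0 addr0 qform0.
by rewrite addr0.
Qed.

(** As a minimal stage value, a sum of nonnegative terms, the Riccati form is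
    nonnegative; this is not visible from its formula, which subtracts. *)
Lemma riccati_possemidef L : possemidef L -> possemidef (riccati D L).
Proof.
move=> psdL; have [sL pL] := psdL; have pT := Theta_of_posdef psdL.
have [sV pV] := mV_psd hD; have [sW pW] := mW2_pd hD; split.
  rewrite /riccati !linearD linearN /= !trmx_mul !trmxK sV trmx_inv sL pT.1.
  by rewrite !mulmxA.
move=> xi; have := stage_value0E xi (best_reply L xi 0) psdL.
rewrite subrr qform0 addr0 => <-; apply: addr_ge0; last exact: pL.
apply: addr_ge0; first exact: pV.
rewrite qform_block qform0 [bform _ 0 _]/bform trmx0 !mul0mx mxE mulr0 !add0r.
have [->|/pW/ltW //] := eqVneq (best_reply L xi 0) 0; by rewrite qform0.
Qed.

Lemma Lambda_possemidef n : possemidef (Lambda D n).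
Proof.
rewrite /Lambda; elim: (horizon D - n)%N => [|k IHk]; first exact: mU_psd.
exact: riccati_possemidef.
Qed.

Lemma LambdaS n : (n < horizon D)%N -> Lambda D n = riccati D (Lambda D n.+1).
Proof. by move=> nN; rewrite /Lambda -[(_ - n)%N]prednK ?subn_gt0 // subnS. Qed.

Lemma best_reply_Psi n xi : best_reply (Lambda D n.+1) xi 0 = Psi D n *m xi.
Proof. by rewrite /best_reply !mulmx0 !addr0 /Psi mulNmx !mulmxA. Qed.

(** Each stage contributes a difference of consecutive values of the forms of
    Lambda, up to the square measuring the distance to the best reply; the
    differences telescope. *)
Lemma cost_to_go_eq (xi : nat -> 'cV[R]_(rho + sigma))
    (u : nat -> 'cV[R]_gamma) (w : nat -> 'cV[R]_omega) m :
  (m <= horizon D)%N ->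
  (forall n, (m <= n < horizon D)%N -> u n = 0 /\
     xi n.+1 = mA D *m xi n + mB D *m col_mx (u n) (w n)) ->
  qform (mU D) (xi (horizon D)) + \sum_(m <= n < horizon D)
     (qform (mV D) (xi n) + qform (mW D) (col_mx (u n) (w n))) =
  qform (Lambda D m) (xi m) +
  \sum_(m <= n < horizon D) qform (Theta D n.+1) (w n - Psi D n *m xi n).
Proof.
move=> mN dyn.
have -> : mU D = Lambda D (horizon D) by rewrite /Lambda subnn.
pose a n := qform (Lambda D n) (xi n); rewrite -/(a m) -/(a (horizon D)).
transitivity (a (horizon D) +
    (\sum_(m <= n < horizon D) qform (Theta D n.+1) (w n - Psi D n *m xi n)
     - \sum_(m <= n < horizon D) (a n.+1 - a n))); last first.
  by rewrite telescope_sumr //; ring.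
rewrite -sumrB; congr (_ + _); apply: eq_big_nat => n mnN.
have [u0 xiS] := dyn n mnN; have /andP[_ nN] := mnN.
have := stage_value0E (xi n) (w n) (Lambda_possemidef n.+1).
rewrite /stage_value best_reply_Psi -LambdaS // -u0 -xiS /a /Theta => E.
by lra.
Qed.

(** The initial state and the upper inputs being given, only the squares depend
    on the lower-level variables: here inside [stage_value] at time 0
    (see [stage_valueE]), and in the sum at later times. *)
Lemma lompc_cost_eq (xi0 : 'cV[R]_(rho + sigma))
    (xi : nat -> 'cV[R]_(rho + sigma))
    (u : nat -> 'cV[R]_gamma) (w : nat -> 'cV[R]_omega) :
  (forall n, u n.+1 = 0) -> lompc_feasible D xi0 u xi w ->
  lompc_cost D xi u w = stage_value (Lambda D 1) xi0 (u 0%N) (w 0%N) +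
  \sum_(1 <= n < horizon D) qform (Theta D n.+1) (w n - Psi D n *m xi n).
Proof.
move=> u0 [<- dyn _ _]; have N0 := horizon_ge1 hD.
have tail := @cost_to_go_eq xi u w 1 N0.
rewrite /lompc_cost /horizon_cost -(big_mkord xpredT (fun n =>
  qform (mV D) (xi n) + qform (mW D) (col_mx (u n) (w n)))) big_ltn //.
rewrite addrCA tail; last first.
  by case=> // n /andP[_ nN]; split; [exact: u0 | exact: dyn].
by rewrite addrA /stage_value -dyn.
Qed.

Lemma lompc_minimizer_of_replies (xi0 : 'cV[R]_(rho + sigma))
    (xi : nat -> 'cV[R]_(rho + sigma))
    (u : nat -> 'cV[R]_gamma) (w : nat -> 'cV[R]_omega) :
  (forall n, u n.+1 = 0) -> lompc_feasible D xi0 u xi w ->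
  w 0%N = best_reply (Lambda D 1) xi0 (u 0%N) ->
  (forall n, (1 <= n < horizon D)%N -> w n = Psi D n *m xi n) ->
  lompc_minimizer D xi0 u xi w.
Proof.
move=> u0 feas w0 wn; split=> // xi' w' feas'.
have pT n v : 0 <= qform (Theta D n) v.
  have [_ pT] := Theta_of_posdef (Lambda_possemidef n).
  have [->|/pT/ltW //] := eqVneq v 0; by rewrite qform0.
rewrite !(@lompc_cost_eq xi0) // !(stage_valueE _ _ _ (Lambda_possemidef 1)).
rewrite -w0 subrr qform0 addr0 [X in _ + X]big_nat big1 => [|n /wn ->].
  rewrite addr0 -[leRHS]addrA lerDl; apply: addr_ge0; first exact: pT.
  by apply: sumr_ge0 => n _; exact: pT.
by rewrite subrr qform0.
Qed.

(** * Feasibility on Xi *)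

Variable G : 'M[R]_(gamma, rho + sigma).

(** Z is the one-step closed-loop matrix when the upper level plays G xi and
    the lower level answers optimally. *)
Lemma mZ_eq xi :
  mZ D G *m xi = mA D *m xi +
    mB D *m col_mx (G *m xi) (best_reply (Lambda D 1) xi (G *m xi)).
Proof.
rewrite mB_col /mZ /stab_A /stab_B /Gamma /best_reply -/(Theta D 1).
rewrite !(mulmxDl, mulmxDr, mulmxBl, mulmxN, mulNmx, mul1mx, mulmxA, opprD).
set a := mA D *m xi; set b := mB1 D *m G *m xi; set c := _ *m mA D *m xi.
set d := _ *m mB1 D *m G *m xi; set e := _ *m xi.
by rewrite -!addrA; congr (_ + _); rewrite addrCA.
Qed.

Definition design_u xi0 (n : nat) : 'cV[R]_gamma :=
  if n is 0%N then G *m xi0 else 0.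

Definition design_w xi0 (n : nat) : 'cV[R]_omega :=
  if n is 0%N then best_reply (Lambda D 1) xi0 (G *m xi0)
  else Psi D n *m Xi_state D G xi0 n.

(** The matrices that define Xi are the optimal replies to (G xi0, 0, ..., 0),
    and the upper inputs 0 are admissible since polU contains the origin.  The
    design constraint is an equality because the state at time 1 is Z xi0. *)
Lemma Xi_bimpc_feasible (H : 'M[R]_(rho + sigma)) xi0 :
  stein (mZ D G) H = 1%:M -> Xi D G xi0 ->
  bimpc_feasible D (lyapunov_constraint H) xi0
    (Xi_state D G xi0) (design_u xi0) (design_w xi0).
Proof.
move=> H1 [Uxi Wxi0 Wxi XY [XN YN]].
have [_ _ U0 _] := polU_polytope hD.
split=> //.
- apply: lompc_minimizer_of_replies => //; last by move=> [|n].
  split=> // [[|n] nN|n nN].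
  + exact: mZ_eq.
  + rewrite mB_col mulmx0 add0r /=.
    by rewrite mulmxDl mulmxA.
  + split; first by have [] := XY n nN.
    case: n nN => [|n] nN; last by apply: Wxi; case: (horizon D) nN.
    suff <- : - (invmx (Theta D 1) *m
        ((mB2 D)^T *m Lambda D 1 *m (mA D + mB1 D *m G) + (mPhi D)^T *m G)
        *m xi0) = design_w xi0 0 by [].
    rewrite /= /best_reply -/(Theta D 1).
    by rewrite -!mulmxA !(mulmxDl, mulmxDr, mulmxA).
- rewrite /lyapunov_constraint /= qform_mulm !qformE.
  by rewrite bformDm bformNm -H1 /stein bformDm bformNm; lra.
- move=> n nN; split; first by have [] := XY n nN.
  by case: n nN.
Qed.

End Riccati.

(** * Closed-loop behaviour *)

Section LyapunovDescent.
Variables (R : realType) (rho sigma gamma omega : nat).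
Variable D : mpc R rho sigma gamma omega.
Variables (G : 'M[R]_(gamma, rho + sigma)) (H : 'M[R]_(rho + sigma)).
Hypothesis hD : mpc_assumptions D.
Hypothesis Zst : schur_stable (mZ D G).
Hypothesis H1 : stein (mZ D G) H = 1%:M.
Local Notation h := (lyapunov_constraint H).

Lemma closed_loop_step_descent z u0 w0 z' : closed_loop_step D h z u0 w0 z' ->
  qform H z' <= qform H z - qform 1%:M z.
Proof.
move=> [xi [u [w [[[_ + _ _] _] _ _ ->]]]].
rewrite /lyapunov_constraint !qformE bformDm bformNm; lra.
Qed.

Lemma reachable_ellipsoid xi0 z z' : ellipsoid H xi0 z -> reachable D h z z' ->
  ellipsoid H xi0 z'.
Proof.
move=> zE; elim=> // {}z' u0 w0 z2 _ z'E /closed_loop_step_descent zz.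
apply: le_trans zz _; apply: le_trans z'E; rewrite gerDl oppr_le0.
exact: qform1_ge0.
Qed.

Lemma recursive_feasibility xi0 z : ellipsoid H xi0 `<=` Xi D G ->
  ellipsoid H xi0 z -> recursively_feasible D h z.
Proof.
move=> EXi zE z' /(reachable_ellipsoid zE)/EXi z'Xi.
by do 3!eexists; exact: (Xi_bimpc_feasible hD H1 z'Xi).
Qed.

Lemma closed_loop_constraints xi u w n : closed_loop D h xi u w ->
  [/\ polX D (usubmx (xi n)), polY D (dsubmx (xi n)),
      polU D (u n) & polW D (w n)].
Proof.
move=> /(_ n)[x [v [y [[[[[<- _ + _] _] _ + _] _] -> -> _]]]].
have N0 := horizon_ge1 hD.
by move=> /(_ _ N0)[? ?] /(_ _ N0)[? ?].
Qed.

(** From |v|_2^2 <= q(v) <= c |v|^2 <= c |v|_2^2, with q the form of H, the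
    descent q(z') <= q(z) - |z|_2^2 becomes q(z') <= (1 - 1/c) q(z). *)
Lemma closed_loop_decay : exists c r : R, [/\ 1 <= c, 0 <= r, r < 1 &
  forall xi u w, closed_loop D h xi u w ->
  forall t, `|xi t| ^+ 2 <= c * `|xi 0%N| ^+ 2 * r ^+ t].
Proof.
have [c c1 cP] := bform_bounded H.
have c0 : 0 < c by exact: lt_le_trans c1.
have r0 : 0 <= 1 - c^-1 by rewrite subr_ge0 invf_le1.
exists c, (1 - c^-1); split=> //; first by rewrite ltrBlDr ltrDl invr_gt0.
move=> xi u w cl.
have qle t : qform H (xi t) <= c * `|xi t| ^+ 2.
  by apply: le_trans (ler_norm _) _; rewrite qformE expr2; exact: cP.
have qdecay t : qform H (xi t) <= qform H (xi 0%N) * (1 - c^-1) ^+ t.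
  elim: t => [|t IHt]; first by rewrite expr0 mulr1.
  apply: le_trans (closed_loop_step_descent (cl t)) _.
  have : c^-1 * qform H (xi t) <= qform 1%:M (xi t).
    rewrite ler_pdivrMl //; apply: le_trans (qle t) _.
    by apply: ler_wpM2l (sqr_norm_le_qform _); exact: ltW.
  have := ler_wpM2r r0 IHt; rewrite exprSr; lra.
move=> t; apply: le_trans (sqr_norm_le_qform _) _.
apply: le_trans (stein_qform_ge Zst _ H1) _; apply: le_trans (qdecay t) _.
by apply: ler_wpM2r; [exact: exprn_ge0 | exact: qle].
Qed.

Lemma closed_loop_stabilizes (S : set 'cV[R]_(rho + sigma)) :
  stabilizes D h S.
Proof.
have [c [r [c1 r0 r1 decay]]] := closed_loop_decay.
have c0 : 0 < c by exact: lt_le_trans c1.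
split=> [e e0|z [u [w cl]] _].
  exists (e / c) => [|z [u [w cl]] _ zd t]; first exact: divr_gt0.
  rewrite -(ltr_pXn2r (n := 2)) ?nnegrE // ?ltW //.
  apply: le_lt_trans (decay _ _ _ cl t) _.
  apply: (@le_lt_trans _ _ (c ^+ 2 * `|z 0%N| ^+ 2)).
    rewrite -[leRHS]mulr1; apply: ler_pM => //.
    - by rewrite mulr_ge0 ?sqr_ge0 ?ltW.
    - exact: exprn_ge0.
    - by apply: ler_wpM2r; rewrite ?sqr_ge0 // expr2 ler_peMr // ltW.
    - by rewrite exprn_ile1 // ltW.
  have cz0 : 0 <= c * `|z 0%N| by rewrite mulr_ge0 // ltW.
  rewrite -exprMn ltr_pXn2r ?nnegrE // ?ltW //.
  by rewrite mulrC -ltr_pdivlMr.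
apply/cvgr0Pnorm_lt => e e0.
have cg : geometric (c * `|z 0%N| ^+ 2) r @ \oo --> 0.
  by apply: cvg_geometric; rewrite ger0_norm.
have e20 : 0 < e ^+ 2 by exact: exprn_gt0.
apply: filterS (cvgr0_norm_lt _ cg _ e20) => t /= small.
rewrite -(ltr_pXn2r (n := 2)) ?nnegrE // ?ltW //.
apply: le_lt_trans small; apply: le_trans (ler_norm _); exact: decay _ _ _ cl t.
Qed.

End LyapunovDescent.

Theorem theorem1 (R : realType) (rho sigma gamma omega : nat)
    (D : mpc R rho sigma gamma omega) (KL : 'M[R]_(omega, rho + sigma))
    (hD : mpc_assumptions D) (hYO : terminal_set D KL)
    (hstab : stabilizable (stab_A D) (stab_B D)) :
  forall G : 'M[R]_(gamma, rho + sigma),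
    schur_stable (mZ D G) ->
    exists H : 'M[R]_(rho + sigma),
      unique (lyapunov_solution (mZ D G)) H /\
      forall xi0 : 'cV[R]_(rho + sigma),
        Xi D G xi0 ->
        ellipsoid H xi0 `<=` Xi D G ->
        [/\ stabilizes D (lyapunov_constraint H) (ellipsoid H xi0),
            forall z, ellipsoid H xi0 z ->
              recursively_feasible D (lyapunov_constraint H) z &
            forall (xi : nat -> 'cV[R]_(rho + sigma))
                   (u : nat -> 'cV[R]_gamma) (w : nat -> 'cV[R]_omega),
              closed_loop D (lyapunov_constraint H) xi u w -> xi 0%N = xi0 ->
              forall n, [/\ polX D (usubmx (xi n)), polY D (dsubmx (xi n)),
                            polU D (u n) & polW D (w n)]].
Proof.
move=> G Zst; have [H [Huniq H1]] := lyapunov_equation_solvable Zst.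
exists H; split=> // xi0 _ EXi; split.
- exact: closed_loop_stabilizes Zst H1 _.
- by move=> z; apply: recursive_feasibility EXi; [exact: hD | exact: H1].
- by move=> xi u w cl _ n; apply: closed_loop_constraints cl; exact: hD.
Qed.
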